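(* Let $K$ be a positive integer. For an increasing Borel map $F:[0,\infty)^K\to[0,\infty)$, the following are equivalent: (i) $F$ is an arbitrary-dependence $e$-merging function; (ii) $F$ is a pointwise $e$-process merger. Moreover, admissibility is the same under the two definitions: $F$ is admissible among arbitrary-dependence $e$-merging functions if and only if it is admissible among pointwise $e$-process mergers. Furthermore, $F$ is an admissible pointwise $e$-process merger if and only if there are coefficients $\lambda_0,\lambda_1,\ldots,\lambda_K\ge0$ with $\sum_{k=0}^K\lambda_k=1$ such that $$F(x_1,\ldots,x_K)=\lambda_0+\sum_{k=1}^K\lambda_kx_k\qquad\text{for all }(x_1,\dots,x_K)\in[0,\infty)^K .$$
   Context: ''Increasing'' means coordinatewise nondecreasing. A null hypothesis $H$ is a set of probability measures on a measurable space. A nonnegative random variable $X$ is an $e$-variable for $H$ if $\mathbb E_P[X]\le1$ for every $P\in H$. A nonnegative process $E=(E_t)_{t\in\mathbb N_0}$ adapted to a filtration $(\mathcal F_t)_{t\in\mathbb N_0}$ is an $H$-$e$-process if $\mathbb E_P[E_\tau]\le1$ for every $P\in H$ and every $(\mathcal F_t)$-stopping time $\tau$ with $P(\tau<\infty)=1$. An increasing Borel map $F:[0,\infty)^K\to[0,\infty)$ is an arbitrary-dependence $e$-merging function if $F(X_1,\ldots,X_K)$ is an $e$-variable whenever $X_1,\ldots,X_K$ are arbitrary, possibly dependent, $e$-variables (on a common measurable space, for the same null hypothesis). It is a pointwise $e$-process merger if, for every filtered statistical model (discrete-time filtered measurable space with a family of probability measures), every null hypothesis $H$, and every $K$-tuple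 of $H$-$e$-processes $M^1,\ldots,M^K$ in the same filtration, the process $t\mapsto F(M^1_t,\ldots,M^K_t)$ is an $H$-$e$-process. Within either class, $F$ is admissible if no other member $G$ of that class satisfies $G\ge F$ everywhere and $G>F$ at some point. *)

(* Defs.v *)
From HB Require Import structures.
From mathcomp Require Import all_boot all_order all_algebra.
From mathcomp Require Import all_classical all_reals all_analysis.

Set Implicit Arguments.
Unset Strict Implicit.
Unset Printing Implicit Defensive.

Import Order.TTheory GRing.Theory Num.Theory.
Import numFieldNormedType.Exports.

Local Open Scope classical_set_scope.
Local Open Scope ring_scope.

(* A map F : [0, oo)^K -> [0, oo) is encoded as a function K.-tuple R -> R;
   only its values on [orthant R K] are ever constrained or used. *)
Definition orthant (R : realType) (K : nat) : set (K.-tuple R) :=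
  [set x | forall k : 'I_K, 0 <= tnth x k].

Definition increasing_on_orthant (R : realType) (K : nat)
    (F : K.-tuple R -> R) : Prop :=
  forall x y : K.-tuple R, orthant x -> orthant y ->
    (forall k : 'I_K, tnth x k <= tnth y k) -> F x <= F y.

Definition increasing_borel_map (R : realType) (K : nat)
    (F : K.-tuple R -> R) : Prop :=
  [/\ forall x, orthant x -> 0 <= F x,
      measurable_fun (@orthant R K) F &
      increasing_on_orthant F].

Definition e_variable (d : measure_display) (T : measurableType d)
    (R : realType) (H : set (probability T R)) (X : T -> R) : Prop :=
  [/\ measurable_fun setT X,
      forall w, 0 <= X w &
      forall P : probability T R, H P -> ('E_P[X] <= 1)%E].

Definition filtration (d : measure_display) (T : measurableType d)
    (Fil : nat -> set (set T)) : Prop :=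
  [/\ forall t, sigma_algebra setT (Fil t),
      forall t, Fil t `<=` measurable &
      forall s t, (s <= t)%N -> Fil s `<=` Fil t].

Record filtered_model (d : measure_display) (T : measurableType d)
    (R : realType) := FilteredModel {
  model_filtration : nat -> set (set T) ;
  model_filtrationP : filtration model_filtration ;
  model_measures : set (probability T R) }.

Definition adapted (d : measure_display) (T : measurableType d) (R : realType)
    (Fil : nat -> set (set T)) (E : nat -> T -> R) : Prop :=
  forall t (B : set R), measurable B -> Fil t (E t @^-1` B).

(* [None] is the value +oo. *)
Definition stopping_time (d : measure_display) (T : measurableType d)
    (Fil : nat -> set (set T)) (tau : T -> option nat) : Prop :=
  forall t, Fil t [set w | exists2 s, tau w = Some s & (s <= t)%N].

(* The value 0 on the event that tau is infinite is arbitrary: [e_process]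
   only uses stopping times for which this event is null. *)
Definition stopped (T : Type) (R : realType) (E : nat -> T -> R)
    (tau : T -> option nat) (w : T) : R :=
  if tau w is Some t then E t w else 0.

Definition e_process (d : measure_display) (T : measurableType d)
    (R : realType) (Fil : nat -> set (set T)) (H : set (probability T R))
    (E : nat -> T -> R) : Prop :=
  [/\ forall t w, 0 <= E t w,
      adapted Fil E &
      forall (P : probability T R) (tau : T -> option nat), H P ->
        stopping_time Fil tau -> P [set w | tau w <> None] = 1%E ->
        ('E_P[stopped E tau] <= 1)%E].

Definition e_merging (R : realType) (K : nat) (F : K.-tuple R -> R) : Prop :=
  increasing_borel_map F /\
  forall (d : measure_display) (T : measurableType d)
         (H : set (probability T R)) (X : 'I_K -> T -> R),
    (forall k, e_variable H (X k)) ->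
    e_variable H (fun w => F [tuple X k w | k < K]).

Definition pointwise_e_process_merger (R : realType) (K : nat)
    (F : K.-tuple R -> R) : Prop :=
  increasing_borel_map F /\
  forall (d : measure_display) (T : measurableType d)
         (S : filtered_model T R) (H : set (probability T R))
         (M : 'I_K -> nat -> T -> R),
    H `<=` model_measures S ->
    (forall k, e_process (model_filtration S) H (M k)) ->
    e_process (model_filtration S) H
      (fun t w => F [tuple M k t w | k < K]).

Definition admissible (R : realType) (K : nat)
    (C : (K.-tuple R -> R) -> Prop) (F : K.-tuple R -> R) : Prop :=
  C F /\
  ~ exists G : K.-tuple R -> R,
      [/\ C G, forall x, orthant x -> F x <= G x &
          exists2 x, orthant x & F x < G x].

(* Main.v *)
Require Import Defs.
From mathcomp Require Import all_boot all_order all_algebra.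
From mathcomp Require Import all_classical all_reals all_analysis.
From mathcomp Require Import measurable_realfun ring lra.

(** The class of arbitrary-dependence e-merging functions and the class of
    pointwise e-process mergers are both equal to the class of increasing Borel
    maps lying below some affine map [lam_0 + lam_1 x_1 + .. + lam_K x_K] with
    convex weights; all three claims are then read off that description.

    A merger of processes merges random variables, because e-variables are
    e-processes that are constant in time ([pointwise_merger_e_merging]). A map
    below a convex combination [lam] merges e-processes, because at a stopping
    time its value is at most the same combination of the stopped processes, and
    expectation is linear ([affinely_dominated_pointwise_merger]).

    The remaining implication, from e-merging to affine domination
    ([e_merging_affinely_dominated]), is a duality argument. For each [x], the
    weights whose affine map is at least [F x] at [x] form a closed subset of the
    compact simplex, so it suffices to treat finitely many points. If no weights
    serve for the points [x_i], a theorem of the alternative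
    ([simplex_alternative]) gives masses [p_i] for which the weighted sum of the
    [F (x_i)] exceeds both the total mass and every coordinate of the weighted sum
    of the [x_i]. Rescaling the masses and putting the missing mass at the origin,
    where [F] is nonnegative, gives K e-variables on a finitely supported
    probability space that [F] merges to a variable of mean greater than 1.

    For admissibility, an affine map with convex weights belongs to the class,
    so an admissible map equals the affine map above it. Conversely, two such
    affine maps take the same value 1 at the interior point (1, .., 1) of the
    orthant, so one of them cannot lie below the other without being equal to it
    ([convex_affine_map_le_eq]); hence nothing in the class improves on an affine
    map. *)

Set Implicit Arguments.
Unset Strict Implicit.
Unset Printing Implicit Defensive.

Import Order.TTheory GRing.Theory Num.Theory.
Import numFieldNormedType.Exports.
Local Open Scope classical_set_scope.
Local Open Scope ring_scope.

(** * A theorem of the alternative over the standard simplex *)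

Definition convex_weights (R : realType) (n : nat) (lam : 'I_n -> R) : Prop :=
  (forall k, 0 <= lam k) /\ \sum_k lam k = 1.

(** The weights are row vectors in order to use the topology of ['rV[R]_n]. *)
Definition std_simplex (R : realType) (n : nat) : set 'rV[R]_n :=
  [set v | convex_weights (v ord0)].

Lemma continuous_row_dot (R : realType) (n : nat) (a : 'I_n -> R) :
  continuous (fun v : 'rV[R]_n => \sum_k v ord0 k * a k).
Proof.
apply: continuous_big => [|k _ v]; first exact: add_continuous.
apply: (@continuousM _ _ (fun v : 'rV[R]_n => v ord0 k) (cst (a k))).
  exact: coord_continuous.
exact: cst_continuous.
Qed.

Lemma compact_std_simplex (R : realType) (n : nat) : compact (@std_simplex R n).
Proof.
pose box := [set v : 'rV[R]_n | forall k, (`[0, 1]%classic : set R) (v ord0 k)].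
apply: (@subclosed_compact _ _ box).
- have -> : @std_simplex R n =
      (\bigcap_k [set v : 'rV[R]_n | 0 <= v ord0 k]) `&`
      [set v | \sum_k v ord0 k * 1 = 1].
    apply/seteqP; split=> v /= [v0 v1]; split.
    + by move=> k _; exact: v0.
    + by under eq_bigr do rewrite mulr1.
    + by move=> k; exact: v0.
    + by under eq_bigr do rewrite -[v _ _]mulr1.
  apply: closedI.
    apply: closed_bigI => k _.
    by apply: (@preimage_closed _ _ (fun v : 'rV[R]_n => v ord0 k) [set r | 0 <= r]);
      [move=> v _; exact: coord_continuous | exact: closed_ge].
  by apply: (@preimage_closed _ _ (fun v : 'rV[R]_n => \sum_k v ord0 k * 1)
      [set r | r = 1]);
    [move=> v _; exact: continuous_row_dot | exact: closed_eq].
- by apply: (@rV_compact R n (fun=> `[0, 1]%classic)) => _; exact: segment_compact.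
- move=> v [v0 v1] k; rewrite /= in_itv/= v0/= -v1 (bigD1 k)//=.
  by rewrite lerDl sumr_ge0.
Qed.

Lemma std_simplex_delta (R : realType) (n : nat) (k : 'I_n) :
  std_simplex (delta_mx ord0 k : 'rV[R]_n).
Proof.
split=> [j|]; first by rewrite mxE ler0n.
rewrite (bigD1 k)//= mxE !eqxx big1 ?addr0// => j /negbTE jk.
by rewrite mxE jk andbF.
Qed.

(** The square of the negative part has second derivative at most 2 wherever it
    is smooth, so a first-order expansion with a quadratic error bounds it from
    above; this replaces differentiating it in [simplex_alternative]. *)
Lemma sqr_negpart_le (R : realType) (u t v : R) :
  Num.max 0 (- (u + t * v)) ^+ 2 <=
  Num.max 0 (- u) ^+ 2 - 2 * t * (Num.max 0 (- u) * v) + t ^+ 2 * v ^+ 2.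
Proof.
set q := Num.max 0 (- u).
have qu : - u <= q by rewrite le_max lexx orbT.
have -> : q ^+ 2 - 2 * t * (q * v) + t ^+ 2 * v ^+ 2 = (q - t * v) ^+ 2 by lra.
case: (leP 0 (- (u + t * v))) => [h|_]; last by rewrite expr0n sqr_ge0.
by rewrite ler_sqr ?nnegrE//; lra.
Qed.

Lemma quadratic_min_slope_le0 (R : realType) (a b : R) :
  (forall t, 0 < t -> t <= 1 -> 2 * t * a <= t ^+ 2 * b) -> a <= 0.
Proof.
move=> h; rewrite leNgt; apply/negP => a0.
have := h 1 ltr01 (lexx _); rewrite expr1n mulr1 mul1r => ab.
have b0 : 0 < b by lra.
have t0 : 0 < a / b by exact: divr_gt0.
have tb : a / b * b = a by rewrite mulfVK// gt_eqF.
have t1 : a / b <= 1 by rewrite ler_pdivrMr// mul1r; lra.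
have := h _ t0 t1.
rewrite expr2 -[_ * _ * b]mulrA tb; nra.
Qed.

(** Ville's theorem of the alternative, with a uniform gap [c]. Minimize over the
    simplex the total squared violation of the constraints: if the minimum [c] is
    positive, the violations themselves are the multipliers [p], and the
    first-order condition in the direction of the [k]-th vertex is the [k]-th
    inequality. *)
Lemma simplex_alternative (R : realType) (n m : nat) (A : 'I_n -> 'I_m.+1 -> R) :
  (exists2 v : 'rV[R]_m.+1, std_simplex v &
     forall i, 0 <= \sum_k v ord0 k * A i k) \/
  (exists p : 'I_n -> R, exists c : R,
     [/\ forall i, 0 <= p i, 0 < c & forall k, \sum_i p i * A i k <= - c]).
Proof.
pose neg (v : 'rV[R]_m.+1) i := Num.max 0 (- \sum_k v ord0 k * A i k).
pose phi v := \sum_i neg v i ^+ 2.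
have neg0 v i : 0 <= neg v i by rewrite le_max lexx.
have phi_cont : continuous phi.
  apply: continuous_big => [|i _ v]; first exact: add_continuous.
  apply: (@cvg_comp _ _ _ (neg^~ i) (fun r => r ^+ 2)); last exact: exprn_continuous.
  apply: (@continuous_max R _ (cst 0) (fun v : 'rV[R]_m.+1 => - \sum_k v ord0 k * A i k)).
    exact: cst_continuous.
  apply: (@continuousN _ _ _ (fun v : 'rV[R]_m.+1 => \sum_k v ord0 k * A i k)).
  exact: continuous_row_dot.
have ne : @std_simplex R m.+1 !=set0.
  by exists (delta_mx ord0 ord0); exact: std_simplex_delta.
have [v /set_mem[v0 v1] vmin] := EVT_min_rV ne (@compact_std_simplex R m.+1)
  (continuous_subspaceT phi_cont).
have [nv0|] := pselect (forall i, neg v i = 0).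
  left; exists v => // i; have := nv0 i; rewrite /neg.
  by case: (leP 0 (- _)) => [h1 h2|h _]; lra.
move=> /existsNP[i0 /eqP ni0]; right; exists (neg v), (phi v); split => //.
  rewrite /phi (bigD1 i0)//= ltr_pwDl// ?exprn_gt0//.
    by rewrite lt_neqAle eq_sym ni0 neg0.
  by rewrite sumr_ge0// => i _; rewrite sqr_ge0.
move=> k.
pose u i := \sum_j v ord0 j * A i j.
have phiE : - phi v = \sum_i neg v i * u i.
  rewrite /phi -sumrN; apply: eq_bigr => i _; rewrite /neg -/(u i) expr2.
  by case: (leP 0 (- u i)) => [_|_]; rewrite ?mul0r ?oppr0// mulrN mulNr opprK.
rewrite phiE -subr_le0 -sumrB; under eq_bigr do rewrite -mulrBr.
apply: (@quadratic_min_slope_le0 _ _ (\sum_i (A i k - u i) ^+ 2)) => t t0 t1.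
(* Move from the minimizer v towards the k-th vertex. *)
pose w : 'rV[R]_m.+1 := (1 - t) *: v + t *: delta_mx ord0 k.
have [d0 d1] := @std_simplex_delta R m.+1 k.
have ws : std_simplex w.
  split=> [j|]; first by rewrite !mxE addr_ge0// mulr_ge0// ?subr_ge0// ?ltW//; case: ifP.
  under eq_bigr => j do rewrite /w mxE mxE [in X in _ + X]mxE.
  rewrite big_split/= -!mulr_sumr v1 d1; lra.
have wu i : \sum_j w ord0 j * A i j = u i + t * (A i k - u i).
  have -> : \sum_j w ord0 j * A i j =
      (1 - t) * u i + t * \sum_j (delta_mx ord0 k : 'rV[R]_m.+1) ord0 j * A i j.
    rewrite !mulr_sumr -big_split/=; apply: eq_bigr => j _.
    by rewrite /w mxE mxE [in X in _ + X]mxE mulrDl !mulrA.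
  rewrite (bigD1 k)//= big1 => [|j /negbTE jk]; last by rewrite mxE jk andbF mul0r.
  rewrite mxE !eqxx addr0 mul1r; lra.
have := vmin w (mem_set ws).
have : phi w <= phi v - 2 * t * (\sum_i neg v i * (A i k - u i))
                + t ^+ 2 * \sum_i (A i k - u i) ^+ 2.
  rewrite /phi !mulr_sumr -sumrB -big_split/=; apply: ler_sum => i _.
  by rewrite /neg wu; exact: sqr_negpart_le.
lra.
Qed.

(** * Affine maps and affine domination *)

Definition affine_map (R : realType) (K : nat) (lam : 'I_K.+1 -> R)
    (x : K.-tuple R) : R :=
  lam ord0 + \sum_(k < K) lam (lift ord0 k) * tnth x k.

(** The coordinate 1 prepended to [x] absorbs the constant term of an affine map,
    which thereby becomes a convex combination like any other. *)
Definition homogenize (R : realType) (K : nat) (x : K.-tuple R)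
    (k : 'I_K.+1) : R :=
  if unlift ord0 k is Some j then tnth x j else 1.

Lemma affine_mapE (R : realType) (K : nat) (lam : 'I_K.+1 -> R) (x : K.-tuple R) :
  affine_map lam x = \sum_k lam k * homogenize x k.
Proof.
rewrite /affine_map big_ord_recl /homogenize unlift_none mulr1; congr (_ + _).
by apply: eq_bigr => k _; rewrite liftK.
Qed.

Definition affinely_dominated (R : realType) (K : nat) (F : K.-tuple R -> R) :
    Prop :=
  increasing_borel_map F /\
  exists2 lam : 'I_K.+1 -> R, convex_weights lam &
    forall x, orthant x -> F x <= affine_map lam x.

(** * From e-merging to affine domination *)

Lemma finite_support_probability (R : realType) (n : nat) (p : nat -> R) :
  (forall i, 0 <= p i) -> \sum_(i < n) p i = 1 ->
  exists P : probability nat R, forall f : nat -> R, (forall i, 0 <= f i) ->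
    'E_P[f]%E = (\sum_(i < n) p i * f i)%:E.
Proof.
move=> p0 p1.
pose mu (i : nat) : measure nat R := mscale (NngNum (p0 i)) \d_i.
have int_mu (f : nat -> R) : (forall i, 0 <= f i) ->
    (\int[msum mu n]_x (f x)%:E)%E = (\sum_(i < n) p i * f i)%:E.
  move=> f0; have mf : measurable_fun [set: nat] (fun x => (f x)%:E : \bar R) by move=> _ Y _.
  rewrite ge0_integral_measure_sum//; last by move=> x _; rewrite lee_fin.
  rewrite -sumEFin; apply: eq_bigr => i _.
  rewrite ge0_integral_mscale//; last by move=> x _; rewrite lee_fin.
  by rewrite integral_dirac//= diracT mul1e EFinM.
have mass1 : msum mu n [set: nat] = 1%E.
  have <- : (\int[msum mu n]_x (cst 1 x)%:E)%E = msum mu n [set: nat].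
    by rewrite -[RHS]mul1e; exact: (@integral_cst _ _ _ (msum mu n) setT measurableT 1).
  rewrite int_mu//.
  by under eq_bigr do rewrite mulr1; rewrite p1.
(* The mass is already 1, so normalizing only provides the probability structure. *)
exists (mnormalize (msum mu n) \d_0%N) => f f0; rewrite unlock.
rewrite -int_mu//; apply: eq_measure_integral => A _ _.
have unit_scale (m : \bar R) : m = 1%E ->
    (if (m == 0%E) || (m == +oo%E) then \d_0%N : set nat -> \bar R
     else fun B => msum mu n B * ((fine m)^-1)%:E)%E A = msum mu n A.
  by move=> ->; rewrite onee_eq0/= invr1 mule1.
exact: unit_scale mass1.
Qed.

(** The coordinates of a random point drawn from the [x i] with probabilities
    [p i] are e-variables for the single law of the index [i]; this turns the
    probabilistic hypothesis into a statement about finite sums. *)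
Lemma e_merging_finite_mean (R : realType) (K : nat) (F : K.-tuple R -> R)
    (n : nat) (p : nat -> R) (x : nat -> K.-tuple R) :
  e_merging F -> (forall i, 0 <= p i) -> \sum_(i < n) p i = 1 ->
  (forall i, orthant (x i)) ->
  (forall k, \sum_(i < n) p i * tnth (x i) k <= 1) ->
  \sum_(i < n) p i * F (x i) <= 1.
Proof.
move=> [[F0 _ _] Fmerge] p0 p1 x0 xmean.
have [P EP] := finite_support_probability p0 p1.
pose X (k : 'I_K) (i : nat) := tnth (x i) k.
have eX k : e_variable [set P] (X k).
  split; first by move=> _ Y _.
    by move=> i; exact: x0.
  by move=> _ ->; rewrite EP ?lee_fin ?xmean// => i; exact: x0.
have [_ _ /(_ P erefl)] := Fmerge _ nat [set P] X eX.
have -> : (fun w => F [tuple X k w | k < K]) = F \o x.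
  by apply/funext => i /=; congr F; apply: eq_from_tnth => k; rewrite tnth_mktuple.
by rewrite EP ?lee_fin// => i; exact: F0.
Qed.

(** Since the weights sum to 1, the inequality [F x <= affine_map v x] is linear
    and homogeneous in [v], which is the form that [simplex_alternative] takes. *)
Lemma e_merging_finite_dominated (R : realType) (K : nat) (F : K.-tuple R -> R)
    (s : seq (K.-tuple R)) :
  e_merging F -> (forall x, x \in s -> orthant x) ->
  exists2 v : 'rV[R]_K.+1, std_simplex v &
    forall x, x \in s -> 0 <= \sum_k v ord0 k * (homogenize x k - F x).
Proof.
move=> Fm s0; have [[F0 _ _] _] := Fm.
pose zero : K.-tuple R := [tuple 0 | k < K].
have zero0 : orthant zero by move=> k; rewrite tnth_mktuple.
pose x i := nth zero s i.
have x0 i : orthant (x i).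
  rewrite /x; have [h|h] := ltnP i (size s); first by apply: s0; exact: mem_nth.
  by rewrite nth_default.
pose A (i : 'I_(size s)) (k : 'I_K.+1) := homogenize (x i) k - F (x i).
have [[v vs vA]|[p [c [p0 c0 pA]]]] := simplex_alternative A.
  exists v => // y ys; have := ys; rewrite -index_mem => iy.
  by have := vA (Ordinal iy); rewrite /A /x /= nth_index.
exfalso.
pose S := \sum_i p i.
pose V := \sum_i p i * F (x i).
(* The total mass and the coordinate sums are at most V - c; the midpoint m of
   that bound and V is positive and still smaller than V. *)
pose m := V - c / 2.
have pV k : \sum_i p i * homogenize (x i) k <= V - c.
  have := pA k; under eq_bigr do rewrite mulrBr.
  by rewrite sumrB -/V; lra.
have SV : S <= V - c.
  have := pV ord0; rewrite /homogenize unlift_none.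
  by under eq_bigr do rewrite mulr1.
have S0 : 0 <= S by exact: sumr_ge0.
have m0 : 0 < m by rewrite /m; lra.
(* The index size s stands for the origin, which receives the remaining mass. *)
pose q i := if insub i is Some j then p j / m else 1 - S / m.
have qlt (i : 'I_(size s)) : q i = p i / m by rewrite /q valK.
have qsize : q (size s) = 1 - S / m by rewrite /q insubN// ltnn.
have Sm : S / m <= 1 by rewrite ler_pdivrMr// mul1r /m; lra.
have q0 i : 0 <= q i.
  by rewrite /q; case: insubP => [j _ _|_]; [rewrite divr_ge0// ltW | rewrite subr_ge0].
have sumq (g : nat -> R) : \sum_(i < (size s).+1) q i * g i =
    (\sum_(i < size s) p i * g i) / m + (1 - S / m) * g (size s).
  rewrite big_ord_recr/= qsize; congr (_ + _).
  by rewrite mulr_suml; apply: eq_bigr => i _; rewrite qlt mulrAC.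
have xsize : x (size s) = zero by rewrite /x nth_default.
have q1 : \sum_(i < (size s).+1) q i = 1.
  under eq_bigr do rewrite -[q _]mulr1.
  rewrite (sumq (cst 1)) mulr1; under eq_bigr do rewrite mulr1.
  by rewrite addrC subrK.
have qmean k : \sum_(i < (size s).+1) q i * tnth (x i) k <= 1.
  rewrite (sumq (fun i => tnth (x i) k)) xsize tnth_mktuple mulr0 addr0.
  rewrite ler_pdivrMr// mul1r; have := pV (lift ord0 k).
  by rewrite /homogenize liftK /m; lra.
have := e_merging_finite_mean Fm q0 q1 x0 qmean.
rewrite (sumq (F \o x)) /= xsize -/V.
apply/negP; rewrite -ltNge.
have : 1 < V / m by rewrite ltr_pdivlMr// mul1r /m; lra.
have : 0 <= (1 - S / m) * F zero by rewrite mulr_ge0 ?subr_ge0// F0.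
lra.
Qed.

Lemma e_merging_affinely_dominated (R : realType) (K : nat) (F : K.-tuple R -> R) :
  e_merging F -> affinely_dominated F.
Proof.
move=> Fm; split; first by case: Fm.
pose g (x : K.-tuple R) :=
  [set v : 'rV[R]_K.+1 | 0 <= \sum_k v ord0 k * (homogenize x k - F x)].
have : \bigcap_(x in @orthant R K) (@std_simplex R K.+1 `&` g x) !=set0.
  have := @compact_std_simplex R K.+1; rewrite compact_In0; apply.
    exists g => // x _.
    apply: (@preimage_closed _ _
      (fun v : 'rV[R]_K.+1 => \sum_k v ord0 k * (homogenize x k - F x))
      [set r | 0 <= r]); last exact: closed_ge.
    by move=> v _; exact: continuous_row_dot.
  move=> D Dorth.
  have [|v vs vD] := @e_merging_finite_dominated _ _ F (finmap.enum_fset D) Fm.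
    by move=> x /Dorth/set_mem.
  by exists v => x /= xD; split => //; exact: vD.
move=> [v vcap].
have vs : std_simplex v.
  have zero0 : @orthant R K [tuple 0 | k < K] by move=> k; rewrite tnth_mktuple.
  by have [] := vcap _ zero0.
exists (v ord0) => // x x0; have [_] := vcap x x0.
rewrite /g affine_mapE /=; under eq_bigr do rewrite mulrBr.
by rewrite sumrB -mulr_suml vs.2 mul1r subr_ge0.
Qed.

(** * From affine domination to merging of e-processes *)

Lemma expectation_convex_comb_le1 (d : measure_display) (T : measurableType d)
    (R : realType) (P : probability T R) (n : nat) (lam : 'I_n -> R)
    (Y : 'I_n -> T -> R) :
  convex_weights lam -> (forall k, measurable_fun setT (Y k)) ->
  (forall k w, 0 <= Y k w) -> (forall k, 'E_P[Y k] <= 1)%E ->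
  ('E_P[fun w => (\sum_k lam k * Y k w)%R] <= 1)%E.
Proof.
move=> [lam0 lam1] mY Y0 EY; rewrite unlock.
under eq_integral => w _ do rewrite -sumEFin.
rewrite ge0_integral_sum//; last 2 first.
- move=> k; apply/measurable_EFinP.
  by apply: measurable_funM => //; exact: measurable_cst.
- by move=> k w _; rewrite lee_fin mulr_ge0.
apply: (@le_trans _ _ (\sum_k (lam k)%:E)%E); last by rewrite sumEFin lam1.
apply: lee_sum => k _.
under eq_integral => w _ do rewrite EFinM.
rewrite ge0_integralZl_EFin//; last 2 first.
- by move=> w _; rewrite lee_fin.
- exact/measurable_EFinP.
rewrite -[leRHS]mule1 lee_wpmul2l ?lee_fin//.
by have := EY k; rewrite unlock.
Qed.

Lemma measurable_stopping_event (d : measure_display) (T : measurableType d)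
    (Fil : nat -> set (set T)) (tau : T -> option nat) (t : nat) :
  filtration Fil -> stopping_time Fil tau -> measurable [set w | tau w = Some t].
Proof.
move=> [_ sub _] stop.
pose S t := [set w | exists2 s, tau w = Some s & (s <= t)%N].
have mS s : measurable (S s) by apply: sub; exact: stop.
(* The event tau = t is tau <= t minus the events tau <= s with s < t. *)
have -> : [set w | tau w = Some t] = S t `\` \bigcup_(s in [set s | (s < t)%N]) S s.
  apply/seteqP; split=> w /=.
    move=> wt; split; first by exists t.
    by move=> [s /= st [s' ]]; rewrite wt => -[<-] ts; move: (leq_ltn_trans ts st); rewrite ltnn.
  move=> [[s ws st] nlt]; rewrite ws; congr Some; apply/eqP.
  rewrite eqn_leq st leqNgt/=; apply/negP => lt_st.
  by apply: nlt; exists s => //; exists s.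
by apply: measurableD => //; exact: bigcup_measurable.
Qed.

Lemma measurable_stopped (d : measure_display) (T : measurableType d)
    (R : realType) (Fil : nat -> set (set T)) (E : nat -> T -> R)
    (tau : T -> option nat) :
  filtration Fil -> adapted Fil E -> stopping_time Fil tau ->
  measurable_fun setT (stopped E tau).
Proof.
move=> filF adE stop _ Y mY; rewrite setTI.
have mtau t := measurable_stopping_event t filF stop.
have mE t : measurable (E t @^-1` Y) by case: filF => _ sub _; apply: sub; exact: adE.
have -> : stopped E tau @^-1` Y =
    (\bigcup_t ([set w | tau w = Some t] `&` E t @^-1` Y)) `|`
    (~` (\bigcup_t [set w | tau w = Some t]) `&` [set w | Y 0]).
  apply/seteqP; split=> w /=; rewrite /stopped.
    case tw: (tau w) => [t|] Yw; first by left; exists t.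
    by right; split => // -[t _] /=; rewrite tw.
  move=> [[t _ [/= -> //]]|[ninf Y0]].
  by case tw: (tau w) => [t|//]; case: ninf; exists t.
apply: measurableU; first by apply: bigcup_measurable => t _; exact: measurableI.
apply: measurableI; first by apply: measurableC; exact: bigcup_measurable.
have [Y0|nY0] := pselect (Y 0).
  by rewrite (_ : [set w | Y 0] = setT)//; apply/seteqP; split.
by rewrite (_ : [set w | Y 0] = set0)//; apply/seteqP; split.
Qed.

Lemma measurable_orthant (R : realType) (K : nat) : measurable (@orthant R K).
Proof.
have -> : @orthant R K =
    \bigcap_(k in [set: 'I_K]) ((fun x : K.-tuple R => tnth x k) @^-1` `[0, +oo[%classic).
  apply/seteqP; split=> x x0 k; first by move=> _ /=; rewrite in_itv/= andbT; exact: x0.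
  by have := x0 k I; rewrite /= in_itv/= andbT.
apply: fin_bigcap_measurable => // k _; rewrite -[_ @^-1` _]setTI.
exact: measurable_tnth.
Qed.

(** Adaptedness at time [t] is measurability for the sigma-algebra [Fil t] in
    place of the ambient one, so the usual composition of measurable maps applies
    once [T] is equipped with [Fil t]. *)
Lemma adapted_comp (d : measure_display) (T : measurableType d) (R : realType)
    (K : nat) (Fil : nat -> set (set T)) (F : K.-tuple R -> R)
    (M : 'I_K -> nat -> T -> R) :
  filtration Fil -> measurable_fun (@orthant R K) F ->
  (forall k, adapted Fil (M k)) -> (forall k t w, 0 <= M k t w) ->
  adapted Fil (fun t w => F [tuple M k t w | k < K]).
Proof.
move=> [sigF _ _] mF adM M0 t B mB.
pose T' := g_sigma_algebraType (Fil t).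
have mFil (A : set T) : (measurable : set (set T')) A = Fil t A.
  by rewrite measurable_g_measurableTypeE.
pose m (w : T') := [tuple M k t w | k < K].
have mm : measurable_fun [set: T'] m.
  apply/measurable_fun_tnthP => k _ Y mY; rewrite setTI mFil.
  rewrite (_ : _ @^-1` Y = M k t @^-1` Y); first exact: adM.
  by apply/seteqP; split => w /=; rewrite tnth_mktuple.
have := mm measurableT _ (mF (@measurable_orthant R K) B mB).
rewrite setTI mFil; congr Fil; apply/seteqP; split => w /=; first by case.
by split => // k; rewrite tnth_mktuple.
Qed.

Lemma affinely_dominated_pointwise_merger (R : realType) (K : nat)
    (F : K.-tuple R -> R) :
  affinely_dominated F -> pointwise_e_process_merger F.
Proof.
move=> [hF [lam lamw Flam]]; split => // d T S H M _ eM.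
have filF := model_filtrationP S.
have M0 k t w : 0 <= M k t w by case: (eM k).
have adM k : adapted (model_filtration S) (M k) by case: (eM k).
have [F0 mF _] := hF.
have Morth t w : orthant [tuple M k t w | k < K] by move=> k; rewrite tnth_mktuple.
have adFM := adapted_comp filF mF adM M0.
split=> // [t w|P tau HP stop tau1]; first exact: F0.
pose Y (k : 'I_K.+1) : T -> R :=
  if unlift ord0 k is Some j then stopped (M j) tau else cst 1.
have Y0 k w : 0 <= Y k w.
  by rewrite /Y; case: unliftP => [j|] _ //; rewrite /stopped; case: (tau w).
have mY k : measurable_fun setT (Y k).
  rewrite /Y; case: unliftP => [j|] _; last exact: measurable_cst.
  exact: (measurable_stopped filF (adM j) stop).
have EY k : ('E_P[Y k] <= 1)%E.
  rewrite /Y; case: unliftP => [j|] _; last by rewrite expectation_cst.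
  by have [_ _] := eM j; apply.
apply: le_trans (expectation_convex_comb_le1 lamw mY Y0 EY).
have sumY0 w : 0 <= \sum_k lam k * Y k w.
  by rewrite sumr_ge0// => k _; rewrite mulr_ge0//; exact: lamw.1.
apply: expectation_le => //.
- exact: (measurable_stopped filF adFM stop).
- by apply: measurable_sum => k; apply: measurable_funM => //; exact: measurable_cst.
- by move=> w; rewrite /stopped; case: (tau w) => // t; exact: F0.
apply/aeW => w; rewrite /stopped; case tw: (tau w) => [t|//].
apply: (le_trans (Flam _ (Morth t w))); rewrite affine_mapE.
apply: ler_sum => k _; rewrite /Y /homogenize.
by case: unliftP => [j|] _ //; rewrite tnth_mktuple /stopped tw.
Qed.

(** Constant processes are e-processes in the constant filtration, and stopping
    at time 0 recovers the merged variable. *)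
Lemma pointwise_merger_e_merging (R : realType) (K : nat) (F : K.-tuple R -> R) :
  pointwise_e_process_merger F -> e_merging F.
Proof.
move=> [hF Fmerge]; split=> // d T H X eX.
have filF : filtration (fun=> @measurable _ T).
  split=> [t|t A //|s t _ A //]; split; first exact: measurable0.
    by move=> A mA; rewrite setTD; exact: measurableC.
  by move=> A mA; exact: bigcup_measurable.
pose S := FilteredModel filF H.
have mX k : measurable_fun setT (X k) by case: (eX k).
have X0 k w : 0 <= X k w by case: (eX k).
have eM k : e_process (model_filtration S) H (fun=> X k).
  have adX : adapted (model_filtration S) (fun=> X k).
    by move=> t B mB; rewrite /= -[_ @^-1` _]setTI; exact: mX.
  split=> // P tau HP stop _; have [_ _ /(_ _ HP)] := eX k.
  apply: le_trans; apply: expectation_le => //.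
  - exact: (measurable_stopped filF adX stop).
  - by move=> w; rewrite /stopped; case: (tau w).
  - by apply/aeW => w; rewrite /stopped; case: (tau w).
have [FX0 adFX EFX] := Fmerge _ T S H (fun k=> fun=> X k) (fun _ h => h) eM.
split=> [_ B mB|w|P HP]; first by rewrite setTI; exact: (adFX 0%N B mB).
  exact: (FX0 0%N).
have := EFX P (fun=> Some 0%N) HP; apply.
  move=> t /=; rewrite (_ : [set w | _] = setT); first exact: measurableT.
  by apply/seteqP; split => // w _; exists 0%N.
by rewrite (_ : [set w | _] = setT) ?probability_setT//; apply/seteqP; split.
Qed.

(** * Admissibility *)

Lemma affine_map_affinely_dominated (R : realType) (K : nat) (lam : 'I_K.+1 -> R) :
  convex_weights lam -> affinely_dominated (affine_map (K := K) lam).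
Proof.
move=> lamw; have lam0 := lamw.1; split; last by exists lam.
split=> [x x0||x y _ _ xy].
- by rewrite addr_ge0// sumr_ge0// => k _; rewrite mulr_ge0// x0.
- apply: measurable_funD; first exact: measurable_cst.
  apply: measurable_sum => k; apply: measurable_funM; first exact: measurable_cst.
  by apply: measurable_funTS; exact: measurable_tnth.
- by rewrite lerD2l; apply: ler_sum => k _; rewrite ler_wpM2l.
Qed.

(** The difference of the two maps is affine and nonnegative on the orthant, and
    vanishes at the interior point (1, .., 1); prolonging the segment from [x]
    slightly beyond that point would make it negative unless it is zero at [x]. *)
Lemma convex_affine_map_le_eq (R : realType) (K : nat) (lam mu : 'I_K.+1 -> R) :
  convex_weights lam -> convex_weights mu ->
  (forall x, orthant x -> affine_map lam x <= affine_map mu x) ->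
  forall x, orthant x -> affine_map lam x = affine_map mu x.
Proof.
move=> [_ lam1] [_ mu1] le_lam_mu x x0.
apply/le_anti; rewrite le_lam_mu//=.
(* y lies beyond the all-ones vector on the line from x; this eps keeps it in
   the orthant. *)
pose s := \sum_(k < K) tnth x k.
have s0 : 0 <= s by rewrite sumr_ge0// => k _; exact: x0.
have xs k : tnth x k <= s.
  by rewrite /s (bigD1 k)//= lerDl sumr_ge0// => j _; exact: x0.
pose eps := (1 + s)^-1.
have eps0 : 0 < eps by rewrite invr_gt0; lra.
have epss : eps * (1 + s) = 1 by rewrite mulVf//; lra.
pose y := [tuple 1 + eps * (1 - tnth x k) | k < K].
have y0 : orthant y.
  move=> k; rewrite tnth_mktuple.
  have : eps * tnth x k <= eps * s by rewrite ler_pM2l.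
  nra.
have affy (nu : 'I_K.+1 -> R) : \sum_k nu k = 1 ->
    affine_map nu y = 1 + eps * (1 - affine_map nu x).
  move=> nu1; rewrite !affine_mapE -{1 2}nu1 -sumrB mulr_sumr -big_split/=.
  apply: eq_bigr => k _; rewrite /homogenize; case: unliftP => [j|] _ /=.
    by rewrite tnth_mktuple; ring.
  by ring.
have := le_lam_mu y y0; rewrite !affy// => h.
by rewrite -(ler_pM2l eps0); lra.
Qed.

Lemma admissible_affinely_dominatedP (R : realType) (K : nat) (F : K.-tuple R -> R) :
  increasing_borel_map F ->
  admissible (@affinely_dominated R K) F <->
  exists2 lam : 'I_K.+1 -> R, convex_weights lam &
    forall x, orthant x -> F x = affine_map lam x.
Proof.
move=> hF; split=> [[[_ [lam lamw Flam]] maxF]|[lam lamw Flam]].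
  exists lam => // x x0; apply/eqP; rewrite eq_le Flam//= leNgt; apply/negP => ltF.
  apply: maxF; exists (affine_map lam); split => //; last by exists x.
  exact: affine_map_affinely_dominated.
split; first by split=> //; exists lam => // x x0; rewrite Flam.
move=> [G [[_ [mu muw Gmu]] FG [x x0]]]; apply/negP; rewrite -leNgt.
have lam_mu : forall x, orthant x -> affine_map lam x = affine_map mu x.
  apply: convex_affine_map_le_eq => // z z0.
  by rewrite -Flam//; exact: le_trans (FG z z0) (Gmu z z0).
by rewrite Flam// lam_mu// Gmu.
Qed.

Theorem theorem4p2 (R : realType) (K : nat) (hK : (0 < K)%N)
    (F : K.-tuple R -> R) (hF : increasing_borel_map F) :
  (e_merging F <-> pointwise_e_process_merger F) /\
  (admissible (@e_merging R K) F <->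
   admissible (@pointwise_e_process_merger R K) F) /\
  (admissible (@pointwise_e_process_merger R K) F <->
   exists lambda : 'I_K.+1 -> R,
     [/\ forall k : 'I_K.+1, 0 <= lambda k,
         \sum_(k < K.+1) lambda k = 1 &
         forall x : K.-tuple R, orthant x ->
           F x = lambda ord0 +
             \sum_(k < K) lambda (lift ord0 k) * tnth x k]).
Proof.
have mergeE : @e_merging R K = @affinely_dominated R K.
  apply/funext => G; apply/propext; split; first exact: e_merging_affinely_dominated.
  by move=> /affinely_dominated_pointwise_merger; exact: pointwise_merger_e_merging.
have processE : @pointwise_e_process_merger R K = @affinely_dominated R K.
  apply/funext => G; apply/propext; split; last exact: affinely_dominated_pointwise_merger.
  by rewrite -mergeE; exact: pointwise_merger_e_merging.
rewrite mergeE processE; split=> //; split=> //.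
apply: (iff_trans (admissible_affinely_dominatedP hF)).
by split=> [[lam [lam0 lam1] Flam]|[lam [lam0 lam1 Flam]]]; exists lam.
Qed.
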